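(* Let $1\le k\le d$ be integers and $\varepsilon>0$. Let $M$ be the randomized mechanism which, on a dataset $D$ over $d$ items, outputs a sequence $S\in[d]^k$ with probability $$\mathbb{P}[M(D)=S]=\frac{\exp\left(\varepsilon u^*(D,S)/2\right)}{\sum_{S'\in[d]^k}\exp\left(\varepsilon u^*(D,S')/2\right)}.$$ Then $M$ is $\varepsilon$-differentially private.
   Context: $[m]=\{1,\dots,m\}$. There are $d$ items, identified with $[d]$. A dataset $D=\{x_1,\dots,x_n\}$ is a finite multiset of user vectors $x_i\in\{0,1\}^d$; the count of item $j$ is $\mathrm{cnt}_D(j)=\sum_{i=1}^n x_{i,j}$. Let $c_1\ge c_2\ge\dots\ge c_d$ be the item counts of $D$ sorted in nonincreasing order. For a sequence $S=(s_1,\dots,s_k)\in[d]^k$ define $$u^*(D,S)=\begin{cases}-\max_{i\in[k]}\left(c_i-\mathrm{cnt}_D(s_i)\right)&\text{if } s_1,\dots,s_k \text{ are distinct},\\ -\infty&\text{otherwise,}\end{cases}$$ with the convention $\exp(-\infty)=0$. Two datasets $D,D'$ are neighbors, $D\sim D'$, if $D'$ can be obtained from $D$ by adding or removing one user vector. A mechanism $M$ with output space $Y$ is $\varepsilon$-differentially private if $\mathbb{P}[M(D)\in T]\le e^{\varepsilon}\,\mathbb{P}[M(D')\in T]$ for all neighboring datasets $D\sim D'$ and all $T\subseteq Y$. *)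

(* Defs.v *)
From HB Require Import structures.
From mathcomp Require Import all_boot all_order all_algebra.
From mathcomp Require Import finmap multiset.
From mathcomp Require Import all_classical all_reals all_analysis.

Set Implicit Arguments.
Unset Strict Implicit.
Unset Printing Implicit Defensive.

Import Order.TTheory GRing.Theory Num.Theory.

Local Open Scope ring_scope.

Record fdist (R : realType) (Y : finType) := FDist {
  pmf :> Y -> R;
  pmf_ge0 : forall y, 0 <= pmf y;
  pmf_sum1 : \sum_y pmf y = 1 }.

Definition Pr (R : realType) (Y : finType) (p : fdist R Y) (T : {set Y}) : R :=
  \sum_(y in T) p y.

(* The d items are the elements of ['I_d]. *)

Definition user (d : nat) : choiceType := {ffun 'I_d -> bool}.

Definition dataset (d : nat) := {mset (user d)}%mset.

Definition neighbors (d : nat) (D D' : dataset d) : Prop :=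
  exists x : user d, D' = (x +` D)%mset \/ D = (x +` D')%mset.

Definition differentially_private (R : realType) (d : nat) (Y : finType)
    (eps : R) (M : dataset d -> fdist R Y) : Prop :=
  forall D D' : dataset d, neighbors D D' ->
  forall T : {set Y}, Pr (M D) T <= expR eps * Pr (M D') T.

(* Users are enumerated with multiplicity. *)
Definition cnt (d : nat) (D : dataset d) (j : 'I_d) : nat :=
  (\sum_(x <- enum_mset D) (x : {ffun 'I_d -> bool}) j)%N.

(* Indexed from 0: [sorted_cnt D i] is the [i.+1]-st largest count, that is
   c_(i+1); only the indices [i < d] are meaningful. *)
Definition sorted_cnt (d : nat) (D : dataset d) (i : nat) : nat :=
  nth 0%N (sort geq [seq cnt D j | j <- enum 'I_d]) i.

(* The differences c_i - cnt(s_i) may be negative, so they are taken in [R];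
   the neutral element [-oo] of the maximum plays no role when [0 < k]. *)
Definition ustar (R : realType) (d k : nat) (D : dataset d)
    (S : k.-tuple 'I_d) : \bar R :=
  if uniq S then
    (- \big[maxe/-oo]_(i < k)
         ((sorted_cnt D i)%:R - (cnt D (tnth S i))%:R)%:E)%E
  else -oo%E.

(* [expeR -oo = 0]; since [ustar] is never [+oo] when [0 < k], for [0 < eps]
   [fine] is only applied to finite values. *)
Definition weight (R : realType) (d k : nat) (eps : R) (D : dataset d)
    (S : k.-tuple 'I_d) : R :=
  fine (expeR (eps%:E * ustar R D S * (2^-1)%:E)%E).

Definition mech_pmf (R : realType) (d k : nat) (eps : R) (D : dataset d)
    (S : k.-tuple 'I_d) : R :=
  weight eps D S / \sum_(S' : k.-tuple 'I_d) weight eps D S'.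

Lemma weight_ge0 (R : realType) (d k : nat) (eps : R) (D : dataset d)
  (S : k.-tuple 'I_d) : 0 <= weight eps D S.
Proof. exact/fine_ge0/expeR_ge0. Qed.

Lemma ustar_fin (R : realType) (d k : nat) (D : dataset d)
    (S : k.-tuple 'I_d) :
  (0 < k)%N -> uniq S -> ustar R D S \is a fin_num.
Proof.
case: k S => // k S _ uS; rewrite /ustar uS fin_numN.
rewrite fin_numElt; apply/andP; split.
  by rewrite big_ord_recl lt_max ltNyr.
by elim/big_rec: _ => // i y _ yoo; rewrite gt_max ltry.
Qed.

Lemma weight_gt0 (R : realType) (d k : nat) (eps : R) (D : dataset d)
    (S : k.-tuple 'I_d) :
  (0 < k)%N -> uniq S -> 0 < weight eps D S.
Proof.
move=> k0 uS; rewrite /weight -(fineK (ustar_fin R D k0 uS)) -!EFinM /=.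
exact: expR_gt0.
Qed.

Lemma sum_weight_gt0 (R : realType) (d k : nat) (eps : R) (D : dataset d) :
  (0 < k)%N -> (k <= d)%N -> 0 < \sum_(S : k.-tuple 'I_d) weight eps D S.
Proof.
move=> k0 kd; pose S := [tuple widen_ord kd i | i < k].
have uS : uniq S.
  rewrite map_inj_uniq ?enum_uniq// => i j /(congr1 val) /= ij.
  exact: val_inj.
rewrite (bigD1 S)//= ltr_pwDl ?weight_gt0//.
by apply: sumr_ge0 => S' _; exact: weight_ge0.
Qed.

Lemma mech_pmf_ge0 (R : realType) (d k : nat) (eps : R) (D : dataset d)
  (S : k.-tuple 'I_d) : 0 <= mech_pmf eps D S.
Proof.
by rewrite divr_ge0 ?weight_ge0// sumr_ge0// => S' _; exact: weight_ge0.
Qed.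

Lemma mech_pmf_sum1 (R : realType) (d k : nat) (eps : R) (D : dataset d) :
  (0 < k)%N -> (k <= d)%N -> \sum_(S : k.-tuple 'I_d) mech_pmf eps D S = 1.
Proof.
by move=> k0 kd; rewrite -mulr_suml divff// gt_eqF// sum_weight_gt0.
Qed.

Definition mechanism (R : realType) (d k : nat) (k_gt0 : (1 <= k)%N)
    (k_le_d : (k <= d)%N) (eps : R) (D : dataset d) : fdist R (k.-tuple 'I_d) :=
  FDist (mech_pmf_ge0 eps D) (mech_pmf_sum1 eps D k_gt0 k_le_d).

(* Main.v *)
(** Adding a user raises every count by 0 or 1, hence also every sorted count,
    because [c_i >= t] just says that at least [i] items have count [>= t].  As
    all these changes have the same sign, each difference [c_i - cnt(s_i)] moves
    by at most 1, and so does [u*].  Thus every weight, and the normalizing sum,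
    changes by a factor of at most [exp(eps/2)]. *)
Require Import Defs.
From mathcomp Require Import all_boot all_order all_algebra.
From mathcomp Require Import finmap multiset lra.
From mathcomp Require Import all_classical all_reals all_analysis.
Import Order.TTheory GRing.Theory Num.Theory.
Local Open Scope ring_scope.

(** In a nonincreasing list the entries at least [t] form a prefix. Positivity of [t] makes the
    default value 0 of [nth] past the end count as below [t]. *)
Lemma leq_nth_sorted_geq (s : seq nat) (t i : nat) : (0 < t)%N ->
  sorted geq s -> (t <= nth 0%N s i)%N = (i < count (leq t) s)%N.
Proof.
move=> t0; elim: s i => [|x s IHs] i xs.
  by rewrite nth_nil ltn0 leqNgt t0.
have {}IHs j := IHs j (path_sorted xs).
have [tx|xt] := leqP t x; first by case: i => [|i]; rewrite /= tx ?add1n ?ltnS.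
have cs0 : count (leq t) s = 0%N.
  apply/eqP; rewrite -leqn0 leqNgt -has_count; apply/hasPn => y ys.
  rewrite -ltnNge; apply: leq_ltn_trans xt.
  have geq_trans : transitive geq by move=> y' x' z' /[swap]; exact: leq_trans.
  by move/(order_path_min geq_trans)/allP: xs; apply.
by case: i => [|i]; rewrite /= ?IHs cs0 (leqNgt t x) xt.
Qed.

Lemma leq_nth_sort_geq (s : seq nat) (t i : nat) : (0 < t)%N ->
  (t <= nth 0%N (sort geq s) i)%N = (i < count (leq t) s)%N.
Proof.
move=> t0; rewrite leq_nth_sorted_geq// ?count_sort//.
by apply: sort_sorted => x y; exact: leq_total.
Qed.

Lemma nth_sort_geq_le (I : Type) (f g : I -> nat) (e : nat) (s : seq I)
    (i : nat) : (forall j, f j <= g j + e)%N ->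
  (nth 0%N (sort geq (map f s)) i <= nth 0%N (sort geq (map g s)) i + e)%N.
Proof.
move=> fg; set a := nth _ _ _.
(* The remaining case makes both thresholds [a] and [a - e] positive. More than [i] indices have [f]
   at least [a], and each of them has [g] at least [a - e]. *)
have [ae|ea] := leqP a e; first exact: leq_trans ae (leq_addl _ _).
have a0 : (0 < a)%N by exact: leq_ltn_trans ea.
have : (a <= nth 0%N (sort geq (map f s)) i)%N by [].
rewrite leq_nth_sort_geq// addnC -leq_subLR leq_nth_sort_geq ?subn_gt0//.
rewrite !count_map => /leq_trans; apply; apply: sub_count => j /= aj.
by rewrite leq_subLR addnC; exact: leq_trans aj (fg j).
Qed.

Lemma cnt_mset1D (d : nat) (x : user d) (D : dataset d) (j : 'I_d) :
  cnt (x +` D)%mset j = ((x : {ffun 'I_d -> bool}) j + cnt D j)%N.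
Proof.
rewrite /cnt (perm_big (x :: enum_mset D)) ?big_cons//.
apply/allP => a _ /=.
by rewrite [eqbLHS]count_mem_mset mset1DE -count_mem_mset (eq_sym a).
Qed.

Lemma neighbors_sym (d : nat) (D D' : dataset d) :
  neighbors D D' -> neighbors D' D.
Proof. by case=> x [?|?]; exists x; [right|left]. Qed.

Lemma neighbors_gap (R : realType) (d : nat) (D D' : dataset d) (i : nat)
    (j : 'I_d) : neighbors D D' ->
  (sorted_cnt D i)%:R - (cnt D j)%:R <=
    (sorted_cnt D' i)%:R - (cnt D' j)%:R + 1 :> R.
Proof.
move=> [x DD'].
(* Moving the negative terms across avoids truncated subtraction in [nat]. *)
suff : (sorted_cnt D i + cnt D' j <= sorted_cnt D' i + cnt D j + 1)%N.
  by rewrite -(ler_nat R) !natrD; lra.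
have cnt_le E (l : 'I_d) : (cnt (x +` E)%mset l <= cnt E l + 1)%N.
  by rewrite cnt_mset1D addnC leq_add2l leq_b1.
have cnt_ge E (l : 'I_d) : (cnt E l <= cnt (x +` E)%mset l + 0)%N.
  by rewrite cnt_mset1D addn0 leq_addl.
(* The 1 is spent only once: on [cnt] if [x] is added to [D], on [sorted_cnt] if it is removed. *)
case: DD' => ->.
- rewrite -addnA leq_add// -[leqRHS]addn0.
  exact/nth_sort_geq_le/cnt_ge.
- rewrite addnAC leq_add//; first exact/nth_sort_geq_le/cnt_le.
  by rewrite -[leqRHS]addn0.
Qed.

Lemma ustar_neighbors (R : realType) (d k : nat) (D D' : dataset d)
    (S : k.-tuple 'I_d) : neighbors D D' -> uniq S ->
  (ustar R D' S <= ustar R D S + 1)%E.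
Proof.
(* Negation reverses the roles: the maximum for [D] must be at most the one for [D'] plus 1, which
   is checked index by index. *)
move=> DD' uS; rewrite /ustar uS -fin_num_oppeB// leeN2 leeBlDr//.
apply/bigmax_leP; split=> [|i _]; first exact: leNye.
pose F (E : dataset d) (j : 'I_k) : \bar R :=
  ((sorted_cnt E j)%:R - (cnt E (tnth S j))%:R)%:E.
apply: (@le_trans _ _ (F D' i + 1)%E); last first.
  exact/leeD2r/(le_bigmax _ (F D')).
by rewrite -EFinD lee_fin; exact: neighbors_gap.
Qed.

Lemma weight_neighbors (R : realType) (d k : nat) (eps : R) (D D' : dataset d)
    (S : k.-tuple 'I_d) : (0 < k)%N -> 0 < eps -> neighbors D D' ->
  weight eps D S <= expR (eps / 2) * weight eps D' S.
Proof.
move=> k0 eps0 /neighbors_sym DD'.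
have [uS|nuS] := boolP (uniq S); last first.
  (* With a repeated item, [ustar] is [-oo] for both datasets. *)
  have -> : weight eps D' S = weight eps D S.
    by rewrite /weight /ustar (negbTE nuS).
  by rewrite ler_peMl ?weight_ge0// -[leLHS]expR0 ler_expR divr_ge0 ?ltW.
have := ustar_neighbors R d k _ _ S DD' uS.
rewrite /weight.
rewrite -(fineK (ustar_fin R D k0 uS)) -(fineK (ustar_fin R D' k0 uS)).
rewrite -EFinD lee_fin -!EFinM /= -expRD ler_expR => h.
nra.
Qed.

Theorem theorem3p2 (R : realType) (d k : nat) (k_ge1 : (1 <= k)%N)
    (k_le_d : (k <= d)%N) (eps : R) (eps_gt0 : 0 < eps) :
  differentially_private eps (mechanism k_ge1 k_le_d eps).
Proof.
move=> D D' DD' T; rewrite /Pr mulr_sumr; apply: ler_sum => S _ /=.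
rewrite /mech_pmf ler_pdivrMr ?sum_weight_gt0//.
rewrite mulrAC mulrA ler_pdivlMr ?sum_weight_gt0// mulrAC -mulrA.
(* After clearing denominators, one factor pays for the weight of [S] and the other for the
   normalizing sum, where [D] and [D'] trade places. *)
have -> : expR eps = expR (eps / 2) * expR (eps / 2).
  by rewrite -expRD -splitr.
rewrite mulrACA; apply: ler_pM.
- exact: weight_ge0.
- by apply: sumr_ge0 => *; exact: weight_ge0.
- exact: weight_neighbors.
- rewrite mulr_sumr; apply: ler_sum => S' _.
  exact/weight_neighbors/neighbors_sym.
Qed.
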